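(* Consider $N$ individuals, a set $M$ of widgets, and the set $X$ of assignments of exactly one widget to each individual with no widget assigned twice. Let $P=(P_{i,i},P_{i,-i})_{i\in N}$ be any preference profile on $X$ in which each individual's preference has lexicographic structure with strict private component $P_{i,i}$ on $M$ and social component $P_{i,-i}$ on $X_{-i}$, and let $P^{ind}=(P_{i,i},P^{ind}_{i,-i})_{i\in N}$ be the profile with the same private components and individualistic social components. Then: (a) $P^{ind}\trianglerighteq P$. (b) $P^{ind}\vartriangleright P$ if there exist some $i\in N$ and two distinct Pareto efficient allocations $x,y\in PE(P)$ such that $x_i=y_i$ and $y_{-i}\succ_{P_{i,-i}}x_{-i}$. (c) $P^{ind}\vartriangleright P$ if $N\ge 3$, $\#(PE(P))\ge 2$ and $(P_{i,-i})_{i\in N}$ is strict.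
   Context: $N$ denotes both the number of individuals and the set $\{1,\dots,N\}$; $M$ denotes both the number of widgets and the set $\{1,\dots,M\}$. The set of admissible allocations is $X:=\{x=(x_i)_{i\in N}\in M^N:\ \#\{i:x_i=k\}\le 1\ \forall k\in M\}$. For $i\in N$, $X_{-i}:=\{x_{-i}=(x_j)_{j\ne i}: x\in X\}$. Preferences are complete and transitive relations, with strict part $\succ$ and indifference part $\sim$; a preference is strict if no two distinct elements are indifferent. Each individual's preference $P_i=(P_{i,i},P_{i,-i})$ on $X$ consists of a strict preference $P_{i,i}$ on $M$ and a preference $P_{i,-i}$ on $X_{-i}$, combined lexicographically: $x\succ_{P_i}y$ if $x_i\succ_{P_{i,i}}y_i$, or if $x_i=y_i$ and $x_{-i}\succ_{P_{i,-i}}y_{-i}$; and $x\sim_{P_i}y$ if $x_i=y_i$ and $x_{-i}\sim_{P_{i,-i}}y_{-i}$. The social component $P_{i,-i}$ is individualistic, denoted $P_{i,-i}^{ind}$, if $x_{-i}\sim_{P_{i,-i}}y_{-i}$ for all $x_{-i},y_{-i}\in X_{-i}$. ''$(P_{i,-i})_{i\in N}$ is strict'' means each $P_{i,-i}$ is a strict preference on $X_{-i}$. Ranking: $R(P_i,x):=1+\#\{z\in X: z\succ_{P_i}x\}$ for $x\in X$; the ranking vector is $R(P,x):=(R(P_1,x),\dots,R(P_N,x))$; inequalities $\le$ between ranking vectors are componentwise. $PE(P)$ is the set of $x\in X$ not Pareto dominated by any $z\in X$, where $z$ Pareto dominates $x$ under $P$ if $z\succsim_{P_i}x$ for all $i$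 and $z\succ_{P_i}x$ for some $i$. Order: $P\trianglerighteq P'$ if there exists an onto mapping $\psi:PE(P')\to PE(P)$ such that $R(P,\psi(x))\le R(P',x)$ for every $x\in PE(P')$. $P\vartriangleright P'$ means $P\trianglerighteq P'$ holds but $P'\trianglerighteq P$ does not. *)

(* Defs.v *)
From HB Require Import structures.
From mathcomp Require Import all_boot.

Set Implicit Arguments.
Unset Strict Implicit.
Unset Printing Implicit Defensive.

Record preference (T : Type) := Preference {
  weakly_prefers :> rel T;
  preference_total : total weakly_prefers;
  preference_trans : transitive weakly_prefers
}.

Definition strictly_prefers (T : Type) (p : preference T) : rel T :=
  fun x y => p x y && ~~ p y x.

Definition indifferent (T : Type) (p : preference T) : rel T :=
  fun x y => p x y && p y x.

Definition is_strict (T : Type) (p : preference T) : Prop :=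
  forall x y : T, indifferent p x y -> x = y.

Definition individualistic (T : Type) : preference T :=
  @Preference T (fun _ _ => true) (fun _ _ => isT) (fun _ _ _ _ _ => isT).

Definition admissible (N M : nat) (x : {ffun 'I_N -> 'I_M}) : bool :=
  [forall k : 'I_M, #|[set i | x i == k]| <= 1].

Record allocation (N M : nat) := Allocation {
  allocation_fun :> {ffun 'I_N -> 'I_M};
  allocation_admissible : admissible allocation_fun
}.

HB.instance Definition _ (N M : nat) := [isSub for @allocation_fun N M].
HB.instance Definition _ (N M : nat) := [Countable of allocation N M by <:].
HB.instance Definition _ (N M : nat) := [Finite of allocation N M by <:].

Definition restriction (N M : nat) (i : 'I_N) (x : allocation N M) :
    {ffun {j : 'I_N | j != i} -> 'I_M} :=
  [ffun j => x (val j)].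

(* X_{-i}: the families indexed by the individuals other than i that extend
   to an admissible allocation *)
Definition allocation_others (N M : nat) (i : 'I_N) : finType :=
  {f : {ffun {j : 'I_N | j != i} -> 'I_M}
     | f \in [set restriction i x | x : allocation N M]}.

Lemma restriction_extends (N M : nat) (i : 'I_N) (x : allocation N M) :
  restriction i x \in [set restriction i x | x : allocation N M].
Proof. exact: imset_f. Qed.

(* x |-> x_{-i} *)
Definition others (N M : nat) (i : 'I_N) (x : allocation N M) :
    allocation_others M i :=
  exist _ (restriction i x) (restriction_extends i x).

Section Lexicographic.

Variables (N M : nat) (i : 'I_N).
Variables (p : preference 'I_M) (q : preference (allocation_others M i)).

Definition lex_rel : rel (allocation N M) := fun x y =>
  strictly_prefers p (x i) (y i) || (x i == y i) && q (others i x) (others i y).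

Hypothesis p_strict : is_strict p.

Lemma lex_rel_total : total lex_rel.
Proof.
move=> x y; rewrite /lex_rel /strictly_prefers.
have [exy|nxy] := eqVneq (x i) (y i).
  by rewrite exy; case/orP: (preference_total q (others i x) (others i y)) => ->;
     rewrite !orbT.
have: ~~ indifferent p (x i) (y i) by apply/negP => /p_strict /eqP; apply/negP.
rewrite /indifferent.
by case/orP: (preference_total p (x i) (y i)) => ->; rewrite ?andbT /= => ->;
   rewrite ?orbT.
Qed.

Lemma lex_rel_trans : transitive lex_rel.
Proof.
move=> y x z; rewrite /lex_rel /strictly_prefers.
have tr := @preference_trans _ p.
case/orP=> [/andP[pxy npyx]|/andP[/eqP exy qxy]].
  case/orP=> [/andP[pyz npzy]|/andP[/eqP <- _]]; last by rewrite pxy npyx.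
  rewrite (tr _ _ _ pxy pyz) /=; apply/orP; left.
  by apply/negP => pzx; move/negP: npyx; apply; apply: tr pyz pzx.
rewrite exy; case/orP=> [->//|/andP[-> qyz]].
by rewrite (preference_trans qxy qyz) orbT.
Qed.

Definition lex_preference : preference (allocation N M) :=
  Preference lex_rel_total lex_rel_trans.

Lemma strictly_prefers_lex (x y : allocation N M) :
  strictly_prefers lex_preference x y =
  strictly_prefers p (x i) (y i)
  || (x i == y i) && strictly_prefers q (others i x) (others i y).
Proof.
rewrite /strictly_prefers /= /lex_rel /strictly_prefers eq_sym.
by have [->|_] := eqVneq (y i) (x i);
   [rewrite !andbN | case: (p (x i) (y i)); case: (p (y i) (x i))].
Qed.

Lemma indifferent_lex (x y : allocation N M) :
  indifferent lex_preference x y =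
  (x i == y i) && indifferent q (others i x) (others i y).
Proof.
rewrite /indifferent /= /lex_rel /strictly_prefers eq_sym.
by have [->|_] := eqVneq (y i) (x i);
   [rewrite !andbN | case: (p (x i) (y i)); case: (p (y i) (x i))].
Qed.

End Lexicographic.

Definition profile (N M : nat) := 'I_N -> preference (allocation N M).

Definition lex_profile (N M : nat) (priv : 'I_N -> preference 'I_M)
    (priv_strict : forall i, is_strict (priv i))
    (soc : forall i : 'I_N, preference (allocation_others M i)) : profile N M :=
  fun i => lex_preference (soc i) (priv_strict i).

Definition ranking (N M : nat) (p : preference (allocation N M))
    (x : allocation N M) : nat :=
  1 + #|[set z | strictly_prefers p z x]|.

Definition ranking_vector (N M : nat) (P : profile N M) (x : allocation N M) :
    {ffun 'I_N -> nat} :=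
  [ffun i => ranking (P i) x].

Definition pareto_dominates (N M : nat) (P : profile N M)
    (z x : allocation N M) : bool :=
  [forall i, P i z x] && [exists i, strictly_prefers (P i) z x].

Definition pareto_efficient (N M : nat) (P : profile N M) :
    {set allocation N M} :=
  [set x | ~~ [exists z, pareto_dominates P z x]].

Definition profile_ge (N M : nat) (P P' : profile N M) : Prop :=
  exists psi : {x | x \in pareto_efficient P'} -> {x | x \in pareto_efficient P},
    (forall y, exists x, psi x = y) /\
    (forall x i, ranking_vector P (val (psi x)) i
                 <= ranking_vector P' (val x) i).

Definition profile_gt (N M : nat) (P P' : profile N M) : Prop :=
  profile_ge P P' /\ ~ profile_ge P' P.

(* Main.v *)
(** Efficiency for [Pind] implies efficiency for [P], and ignoring the social
    components only lowers ranking numbers.  So [psi] may fix the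
    [Pind]-efficient allocations and send every other one to a
    [Pind]-efficient allocation weakly above it.  Conversely, if [P] dominates
    [Pind], a section of the onto map is an injection of [PE(P)] into itself;
    summing the rankings over [PE(P)] forces them to agree under [P] and [Pind]
    at every point of [PE(P)], which fails at an allocation [x] as in (b).  For
    (c), if all individuals have distinct favourite widgets then [PE(Pind)] has
    at most one element, too few for an onto map.  Otherwise two individuals
    share a favourite [k]; give [k] to either of them, and to a third
    individual the best widget other than [k]: this yields two
    [Pind]-efficient allocations to which (b) applies. *)

Require Import Defs.
From mathcomp Require Import all_boot perm.

Set Implicit Arguments.
Unset Strict Implicit.
Unset Printing Implicit Defensive.

(** * Complete preorders and their strict parts *)

Section Preference.

Variables (T : Type) (p : preference T).

Lemma preference_refl : reflexive p.
Proof. by move=> x; have := preference_total p x x; rewrite orbb. Qed.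

Lemma strictly_prefers_irr (x : T) : strictly_prefers p x x = false.
Proof. by rewrite /strictly_prefers andbN. Qed.

Lemma strictly_prefersW (x y : T) : strictly_prefers p x y -> p x y.
Proof. by case/andP. Qed.

Lemma strictly_prefers_trans (z x y : T) :
  strictly_prefers p z x -> p x y -> strictly_prefers p z y.
Proof.
case/andP=> pzx npxz pxy; rewrite /strictly_prefers (preference_trans pzx pxy).
by apply/negP => pyz; case/negP: npxz; apply: preference_trans pxy pyz.
Qed.

Lemma strict_preference_eqVstrict (x y : T) :
  is_strict p -> p x y -> x = y \/ strictly_prefers p x y.
Proof.
move=> p_strict pxy; case pyx: (p y x); last by right; rewrite /strictly_prefers pxy pyx.
by left; apply: p_strict; rewrite /indifferent pxy.
Qed.

Lemma strict_preference_neq (x y : T) :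
  is_strict p -> x <> y -> strictly_prefers p x y \/ strictly_prefers p y x.
Proof.
move=> p_strict nxy; have [pxy|pyx] := orP (preference_total p x y).
  by have [//|sxy] := strict_preference_eqVstrict p_strict pxy; left.
by have [/esym //|syx] := strict_preference_eqVstrict p_strict pyx; right.
Qed.

End Preference.

Lemma exists_most_preferred (T : finType) (p : preference T) (A : pred T) (x0 : T) :
  A x0 -> exists2 x, A x & forall y, A y -> p x y.
Proof.
move=> Ax0.
by case: (@extremumP _ _ p _ A id (preference_refl p) (@preference_trans _ p)
            (preference_total p) Ax0) => x Ax xmax; exists x.
Qed.

(** * Allocations, rankings and the order on arbitrary profiles *)

Section Profiles.

Variables (N M : nat).
Implicit Types (P Q : profile N M) (p q : preference (allocation N M)).
Implicit Types x y z : allocation N M.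

Lemma allocation_inj x : injective x.
Proof.
move=> i j exij; have /forallP/(_ (x i)) := allocation_admissible x.
move/card_le1_eqP; apply; by rewrite inE ?exij.
Qed.

Lemma injective_admissible (f : {ffun 'I_N -> 'I_M}) : injective f -> admissible f.
Proof.
move=> f_inj; apply/forallP => k; apply/card_le1_eqP => i j.
by rewrite !inE => /eqP fi /eqP fj; apply: f_inj; rewrite fi fj.
Qed.

(** Transposing the widgets [x i] and [k] works whether [k] is free or held: a holder of [k]
    receives [x i] in exchange. *)
Lemma reassign x (i : 'I_N) (k : 'I_M) :
  exists2 z : allocation N M, z i = k
    & forall j, j != i -> x j != k -> z j = x j.
Proof.
pose f : {ffun 'I_N -> 'I_M} := [ffun j => tperm (x i) k (x j)].
have f_inj : injective f.
  by move=> j l; rewrite !ffunE => /perm_inj /allocation_inj.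
exists (Allocation (injective_admissible f_inj)); first by rewrite /= ffunE tpermL.
move=> j nji njk; rewrite /= ffunE tpermD 1?eq_sym //.
by apply: contra nji => /eqP /allocation_inj ->.
Qed.

Lemma ranking_le p x y : p x y -> ranking p x <= ranking p y.
Proof.
move=> pxy; rewrite leq_add2l; apply/subset_leq_card/subsetP => z.
by rewrite !inE => szx; apply: strictly_prefers_trans szx pxy.
Qed.

Lemma ranking_lt p x y : strictly_prefers p x y -> ranking p x < ranking p y.
Proof.
move=> sxy; rewrite /ranking ltn_add2l; apply/proper_card/properP; split.
  apply/subsetP => z; rewrite !inE => szx.
  exact: strictly_prefers_trans szx (strictly_prefersW sxy).
by exists x; rewrite !inE ?strictly_prefers_irr.
Qed.

(** Among the allocations weakly above [x] for everyone, take one with the least sum of rankings.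
    Anything dominating it would still be above [x] and have a smaller sum. *)
Lemma pareto_efficient_above P x :
  exists2 z, z \in pareto_efficient P & forall i, P i z x.
Proof.
pose above := [pred z | [forall i, P i z x]].
have above_x : above x by apply/forallP => i; apply: preference_refl.
case: (@arg_minnP _ x above (fun z => \sum_i ranking (P i) z) above_x).
move=> z /forallP zx zmin; exists z => //.
rewrite inE; apply/negP => /existsP[w /andP[/forallP wz /existsP[i swz]]].
have /zmin : above w.
  by apply/forallP => j; apply: preference_trans (wz j) (zx j).
rewrite leqNgt => /negP; apply.
rewrite (bigD1 i) //= [X in _ < X](bigD1 i) //= -addSn.
by apply: leq_add; [apply: ranking_lt | apply: leq_sum => j _; apply: ranking_le].
Qed.

Lemma profile_ge_of_subset P Q :
  pareto_efficient P \subset pareto_efficient Q ->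
  (forall i x, ranking (P i) x <= ranking (Q i) x) ->
  profile_ge P Q.
Proof.
move=> /subsetP sub rank_le.
have /fin_all_exists[psi psiP] (u : {x | x \in pareto_efficient Q}) :
    exists v : {x | x \in pareto_efficient P},
      (val u \in pareto_efficient P -> val v = val u)
      /\ forall i, ranking (P i) (val v) <= ranking (Q i) (val u).
  (* Fixing the points already efficient for [P] is what makes [psi] onto. *)
  have [Pu|nPu] := boolP (val u \in pareto_efficient P).
    by exists (exist _ (val u) Pu); split=> // i; apply: rank_le.
  have [z Pz zu] := pareto_efficient_above P (val u).
  exists (exist _ z Pz); split=> // i.
  exact: leq_trans (ranking_le (zu i)) (rank_le _ _).
exists psi; split=> [y|u i]; last by rewrite !ffunE; case: (psiP u).
exists (exist _ (val y) (sub _ (valP y))); apply: val_inj.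
by have [/(_ (valP y))] := psiP (exist _ (val y) (sub _ (valP y))).
Qed.

Lemma profile_ge_ranking_eq P Q :
  pareto_efficient Q \subset pareto_efficient P ->
  (forall i x, ranking (Q i) x <= ranking (P i) x) ->
  profile_ge P Q ->
  forall i x, x \in pareto_efficient P -> ranking (P i) x = ranking (Q i) x.
Proof.
move=> /subsetP sub rank_le [phi [/fin_all_exists[g phiK] phi_le]] i x Px.
pose S : finType := {x | x \in pareto_efficient P}.
(* The section [g] followed by the inclusion of the efficient sets; being injective on a finite set,
   [h] may reindex the sum. *)
pose h (y : S) : S :=
  exist _ (val (g y)) (sub _ (valP (g y))).
have h_inj : injective h.
  by move=> y z [] /val_inj eg; rewrite -(phiK y) eg phiK.
have sum_le : \sum_(y : S) ranking (P i) (val y)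
    <= \sum_(y : S) ranking (Q i) (val y).
  rewrite [X in _ <= X](reindex_inj h_inj).
  apply: leq_sum => y _; have := phi_le (g y) i.
  by rewrite !ffunE phiK.
apply/eqP; rewrite eqn_leq rank_le andbT leqNgt; apply/negP => lt_x.
move: sum_le; rewrite leqNgt => /negP; apply.
pose u : S := exist _ x Px.
rewrite (bigD1 u) //= [X in _ < X](bigD1 u) //= -addSn.
by apply: leq_add => //; apply: leq_sum => y _; apply: rank_le.
Qed.

End Profiles.

(** * Lexicographic profiles and their individualistic counterparts *)

Section Lexicographic.

Variables (N M : nat) (priv : 'I_N -> preference 'I_M).
Hypothesis priv_strict : forall i, is_strict (priv i).
Variable soc : forall i : 'I_N, preference (allocation_others M i).
Implicit Types x y z : allocation N M.

Let P : profile N M := lex_profile priv_strict soc.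
Let Pind : profile N M :=
  lex_profile priv_strict (fun i => individualistic (allocation_others M i)).

Lemma lex_private i x y : P i x y -> priv i (x i) (y i).
Proof.
case/orP=> [/andP[] //|/andP[/eqP-> _]]; exact: preference_refl.
Qed.

Lemma individualistic_lexE i x y : Pind i x y = priv i (x i) (y i).
Proof.
rewrite /Pind /lex_profile /= /lex_rel andbT.
apply/orP/idP => [[/andP[] //|/eqP->]|pxy].
  exact: preference_refl.
have [->|sxy] := strict_preference_eqVstrict (@priv_strict i) pxy; last by left.
by right.
Qed.

Lemma individualistic_strictE i x y :
  strictly_prefers (Pind i) x y = strictly_prefers (priv i) (x i) (y i).
Proof. by rewrite /strictly_prefers !individualistic_lexE. Qed.

(** Private preferences are strict, so a weak improvement that changes someone's widget is strict
    for that individual and would dominate [x]. *)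
Lemma individualistic_pareto_efficient_eq x z :
  x \in pareto_efficient Pind -> (forall i, priv i (z i) (x i)) -> z = x.
Proof.
rewrite inE => /existsPn/(_ z) ndom zx; apply/val_inj/ffunP => i.
have [//|szx] := strict_preference_eqVstrict (@priv_strict i) (zx i).
case/negP: ndom; apply/andP; split.
  by apply/forallP => j; rewrite individualistic_lexE.
by apply/existsP; exists i; rewrite individualistic_strictE.
Qed.

Lemma individualistic_pareto_efficient_sub :
  pareto_efficient Pind \subset pareto_efficient P.
Proof.
apply/subsetP => x PEx; rewrite inE; apply/existsPn => z.
apply/negP => /andP[/forallP zx /existsP[i]].
rewrite (individualistic_pareto_efficient_eq PEx (fun j => lex_private (zx j))).
by rewrite strictly_prefers_irr.
Qed.

Lemma individualistic_ranking_le i x : ranking (Pind i) x <= ranking (P i) x.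
Proof.
rewrite leq_add2l; apply/subset_leq_card/subsetP => z.
rewrite !inE individualistic_strictE => szx.
by rewrite /P /lex_profile strictly_prefers_lex szx.
Qed.

Lemma individualistic_ranking_lt i x y :
  x i = y i -> strictly_prefers (soc i) (others i y) (others i x) ->
  ranking (Pind i) x < ranking (P i) x.
Proof.
move=> exy syx; rewrite /ranking ltn_add2l; apply/proper_card/properP; split.
  apply/subsetP => z; rewrite !inE individualistic_strictE => szx.
  by rewrite /P /lex_profile strictly_prefers_lex szx.
(* [y] itself is counted by the ranking under [P] only: it ties with [x] privately and wins
   socially. *)
exists y; rewrite inE.
  by rewrite /P /lex_profile strictly_prefers_lex exy eqxx syx orbT.
by rewrite individualistic_strictE exy strictly_prefers_irr.
Qed.

Lemma individualistic_ge : profile_ge Pind P.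
Proof.
exact: profile_ge_of_subset individualistic_pareto_efficient_sub
  individualistic_ranking_le.
Qed.

Lemma not_ge_individualistic i x y :
  x \in pareto_efficient P -> x i = y i ->
  strictly_prefers (soc i) (others i y) (others i x) ->
  ~ profile_ge P Pind.
Proof.
move=> PEx exy syx ge.
have := individualistic_ranking_lt exy syx.
by rewrite (profile_ge_ranking_eq individualistic_pareto_efficient_sub
  individualistic_ranking_le ge) // ltnn.
Qed.

(** * Two efficient allocations that agree on one individual's widget *)

Lemma others_inj i x y : x i = y i -> others i x = others i y -> x = y.
Proof.
move=> exy /(congr1 val)/= /ffunP eo; apply/val_inj/ffunP => j.
have [->//|nji] := eqVneq j i.
by have := eo (exist _ j nji); rewrite !ffunE.
Qed.

(** Move [k] to [i], then [a] to [c], and pass to an efficient allocation above. There [i] keeps a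
    favourite, so [k] is out of reach for [c], who cannot do better than [a]. *)
Lemma pareto_efficient_with (i c : 'I_N) (k a : 'I_M) x :
  c != i -> a != k -> (forall m, priv i k m) ->
  (forall m, m != k -> priv c a m) ->
  exists2 z, z \in pareto_efficient Pind & z i = k /\ z c = a.
Proof.
move=> nci nak kmax amax.
have [x1 x1i _] := reassign x i k; have [x2 x2c x2E] := reassign x1 c a.
have x2i : x2 i = k by rewrite x2E ?x1i 1?eq_sym.
have [z PEz zx] := pareto_efficient_above Pind x2.
have zi : z i = k.
  apply: (@priv_strict i); rewrite /indifferent kmax andbT.
  by have := zx i; rewrite individualistic_lexE x2i.
exists z => //; split=> //; apply: (@priv_strict c); rewrite /indifferent.
have := zx c; rewrite individualistic_lexE x2c => -> /=; apply: amax.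
by rewrite -zi; apply: contra nci => /eqP /allocation_inj ->.
Qed.

Lemma third_individual (i j : 'I_N) : 3 <= N -> exists2 c, c != i & c != j.
Proof.
move=> N3; have /card_gt0P[c] : 0 < #|~: [set i; j]|.
  rewrite cardsCs setCK card_ord subn_gt0.
  by apply: leq_ltn_trans N3; rewrite cards2; case: (_ != _).
by rewrite !inE negb_or => /andP[nci ncj]; exists c.
Qed.

Lemma individualistic_common_assignment x y :
  3 <= N -> x \in pareto_efficient Pind -> y \in pareto_efficient Pind -> x <> y ->
  exists (c : 'I_N) (z w : allocation N M),
    [/\ z \in pareto_efficient Pind, w \in pareto_efficient Pind, z <> w & z c = w c].
Proof.
move=> N3 PEx PEy nxy.
have /fin_all_exists[t tmax] (i : 'I_N) : exists k, forall m, priv i k m.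
  have [k _ kmax] := @exists_most_preferred _ (priv i) xpredT (x i) isT.
  by exists k => m; apply: kmax.
have [/injectiveP t_inj|/injectivePn[i [j nij etij]]] := boolP (injectiveb t).
  have f_inj : injective (finfun t) by move=> i j; rewrite !ffunE => /t_inj.
  (* Everyone gets a favourite in [z], so both [x] and [y] must equal [z]. *)
  pose z := Allocation (injective_admissible f_inj).
  have zmax u i : priv i (z i) (u i) by rewrite ffunE.
  case: nxy; rewrite -(individualistic_pareto_efficient_eq PEx (z := z)) //.
  exact: individualistic_pareto_efficient_eq PEy _.
have [c nci ncj] := third_individual i j N3.
(* A second widget exists because [x] gives [i] and [j] different ones. *)
have nk : exists a, a != t i.
  have [xi|] := eqVneq (x i) (t i); last by exists (x i).
  by exists (x j); rewrite -xi; apply: contra nij => /eqP /allocation_inj ->.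
have [a0 na0] := nk.
have [a nak amax] := @exists_most_preferred _ (priv c) [pred m | m != t i] a0 na0.
have [z PEz [zi zc]] := pareto_efficient_with x nci nak (tmax i) amax.
have jmax m : priv j (t i) m by rewrite etij.
have [w PEw [wj wc]] := pareto_efficient_with x ncj nak jmax amax.
(* If [z] and [w] were equal, [i] and [j] would both hold [t i]. *)
exists c, z, w; split; rewrite ?zc ?wc // => ezw.
by move: nij; rewrite (@allocation_inj _ _ w i j) ?eqxx // wj -ezw zi.
Qed.

End Lexicographic.

Theorem theorem3 (N M : nat) (priv : 'I_N -> preference 'I_M)
    (priv_strict : forall i : 'I_N, is_strict (priv i))
    (soc : forall i : 'I_N, preference (allocation_others M i)) :
  let P : profile N M := lex_profile priv_strict soc in
  let Pind : profile N M :=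
    lex_profile priv_strict
      (fun i : 'I_N => individualistic (allocation_others M i)) in
  [/\ profile_ge Pind P,
      (exists (i : 'I_N) (x y : allocation N M),
         [/\ x \in pareto_efficient P, y \in pareto_efficient P, x <> y,
             x i = y i & strictly_prefers (soc i) (others i y) (others i x)]) ->
      profile_gt Pind P
    & 3 <= N -> 2 <= #|pareto_efficient P| ->
      (forall i : 'I_N, is_strict (soc i)) ->
      profile_gt Pind P].
Proof.
move=> P Pind; have ge : profile_ge Pind P by apply: individualistic_ge.
split=> // [[i [x [y [PEx _ _ exy syx]]]]|N3 card2 soc_strict].
  by split=> //; apply: not_ge_individualistic PEx exy syx.
split=> // ge'; have [phi [phi_onto _]] := ge'.
have [x [y [PEx PEy nxy]]] := card_gt1P card2.
(* Preimages of [x] and [y] are two distinct members of [PE(Pind)]. *)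
have [u phiu] := phi_onto (exist _ x PEx).
have [v phiv] := phi_onto (exist _ y PEy).
have nuv : val u <> val v.
  by move=> /val_inj euv; move: phiv nxy; rewrite -euv phiu => -[->]; rewrite eqxx.
have [c [z [w [PEz PEw nzw ezw]]]] :=
  individualistic_common_assignment N3 (valP u) (valP v) nuv.
have /subsetP sub := individualistic_pareto_efficient_sub priv_strict soc.
have no : others c z <> others c w by move/(others_inj ezw).
(* Whichever of [z] and [w] is socially worse for [c] has different rankings under [P] and
   [Pind]. *)
have [szw|swz] := strict_preference_neq (soc_strict c) no.
  exact: not_ge_individualistic (sub _ PEw) (esym ezw) szw ge'.
exact: not_ge_individualistic (sub _ PEz) ezw swz ge'.
Qed.
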